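(* Let $T>0$, let $\delta\in[0,2)$, and let $\gamma:(0,T]\to\mathbb{R}$ be a continuously differentiable, increasing and concave function such that $x^{\delta}\gamma'(x)=\mathcal{O}(1)$ as $x\to0^{+}$. For $k\in\mathbb{N}=\{0,1,2,\dots\}$ put $$c_k(\gamma):=\frac{2}{T}\int_0^T\gamma(t)\cos\frac{k\pi t}{T}\,\mathrm{d}t .$$ Then: (i) $c_k(\gamma)$ is well defined for every $k\in\mathbb{N}$; (ii) $c_k(\gamma)\le 0$ for all $k\ge1$; (iii) $|c_k(\gamma)|=\mathcal{O}\left(\frac{1}{k^{2-\delta}}\right)$ as $k\to\infty$.
   Context: ''Well defined'' means that $\gamma$ is integrable on $(0,T]$, so that the integrals exist. The notation $a_k=\mathcal{O}(b_k)$ means $a_k\le C b_k$ for some constant $C>0$ not depending on $k$ (it may depend on $\gamma,\delta,T$). *)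

(* Defs.v *)
From HB Require Import structures.
From mathcomp Require Import all_boot all_order all_algebra.
From mathcomp Require Import all_classical all_reals all_analysis.

Set Implicit Arguments.
Unset Strict Implicit.
Unset Printing Implicit Defensive.

Import Order.TTheory GRing.Theory Num.Theory.
Import numFieldNormedType.Exports.

Local Open Scope classical_set_scope.
Local Open Scope ring_scope.

Section Derivative_along_a_set.
Variables (R : realType) (D : set R) (f : R -> R).

(* The difference quotient at x only sees points of D, so at an endpoint of an
   interval D the derivative is one-sided and values of f off D are irrelevant. *)
Definition derivable_within (x : R) : Prop :=
  cvg ((f y - f x) / (y - x) @[y --> within D x^']).

Definition derive_within (x : R) : R :=
  lim ((f y - f x) / (y - x) @[y --> within D x^']).

Definition continuously_differentiable_on : Prop :=
  {in D, forall x, derivable_within x} /\ {within D, continuous derive_within}.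

Definition concave_on : Prop := @convex_function R R^o D (\- f).

End Derivative_along_a_set.

Definition cos_coef_integrand (R : realType) (T : R) (g : R -> R) (k : nat)
    (t : R) : R :=
  g t * cos (k%:R * pi * t / T).

(* Lebesgue integral; [Rintegral] takes the junk value 0 where the integral is
   infinite or undefined, so integrability has to be asserted separately. *)
Definition cos_coef (R : realType) (T : R) (g : R -> R) (k : nat) : R :=
  2 / T * Rintegral lebesgue_measure `]0, T] (cos_coef_integrand T g k).

(* Main.v *)
Require Import Defs.
From HB Require Import structures.
From mathcomp Require Import all_boot all_order all_algebra.
From mathcomp Require Import all_classical all_reals all_analysis.
From mathcomp Require Import unstable measurable_realfun.
From mathcomp Require Import ring lra.

(** Integrating by parts would reduce everything to the integrals of
    g' sin, whose half-periods alternate in sign and decrease in size.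
    The same alternation is visible without differentiating g, and that is
    the route taken here.

    Put h = T / k and cut (0, T] into the k half-periods (jh, jh + h] of the
    cosine.  The cosine is odd about the midpoint of each of them, so folding a
    half-period at its midpoint turns its contribution into - (-1)^j A_j, with
      A_j = \int_0^{h/2} (g(jh + h - s) - g(jh + s)) cos(k pi s / T) ds.
    On (0, h/2) the cosine is nonnegative; the increment of g is nonnegative
    because g is increasing and decreases with j because g is concave.  Hence
    A_0 >= A_1 >= ... >= 0, and the alternating sum of the A_j lies between 0
    and A_0 ([cos_coef_bounds]).  The lower bound makes c_k nonpositive, and the
    upper bound reduces its decay to an estimate of A_0, which only involves g
    on (0, h).

    For this estimate, the growth condition on g', which may be assumed on the
    whole of (0, T) ([derive_within_bigO_global]), is compared with the
    derivative of a power.  Choose an exponent q in (0, 1) with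
    delta <= q + 1.  Then
      g' <= C x^{-delta} <= C t^{q + 1 - delta} x^{-(q + 1)} on (0, t],
    so that
      g(t) - g(s) <= (C / q) t^{q + 1 - delta} s^{-q}
    ([increment_le_powRN]).  As q < 1, the right-hand side is integrable in s
    down to 0.  With t = T / 2 this gives the integrability of g.  With
    t = h - s it gives A_0 = O(h^{q + 1 - delta} h^{1 - q}) = O(h^{2 - delta}),
    and h is a multiple of 1 / k. *)

Import Order.TTheory GRing.Theory Num.Theory.
Import numFieldNormedType.Exports.

Local Open Scope classical_set_scope.
Local Open Scope ring_scope.

Set Implicit Arguments.
Unset Strict Implicit.

(** * Alternating sums, concavity, one-sided derivatives *)

Lemma cosDnatpi (R : realType) (n : nat) (x : R) :
  cos (n%:R * pi + x) = (-1) ^+ n * cos x.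
Proof. by rewrite addrC mulr_natl (alternatingn (@cosDpi R)). Qed.

(** Peeling off the first term leaves minus an alternating sum of the shifted
    sequence, which by induction is between 0 and [A 1]. *)
Lemma alternating_sum_bounds (R : realDomainType) (A : nat -> R) (n : nat) :
  (forall j, (j <= n)%N -> 0 <= A j) ->
  (forall j, (j < n)%N -> A j.+1 <= A j) ->
  0 <= \sum_(j < n.+1) (-1) ^+ j * A j <= A 0%N.
Proof.
elim: n A => [|n IHn] A A_ge0 A_dec.
  by rewrite big_ord1 expr0 mul1r lexx A_ge0.
rewrite big_ord_recl expr0 mul1r.
under eq_bigr do rewrite lift0 exprS mulN1r mulNr.
rewrite sumrN.
have /andP[] := IHn (fun j => A j.+1) (fun j => A_ge0 j.+1) (fun j => A_dec j.+1).
have := A_dec 0%N (ltn0Sn _); rewrite /=; lra.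
Qed.

(** The points [b] and [a + h] divide the segment from [a] to [b + h] in
    opposite proportions, so adding the two concavity inequalities cancels the
    weights and gives g(a) + g(b + h) <= g(b) + g(a + h). *)
Lemma concave_increment_le (R : realType) (D : set R) (g : R -> R) (a b h : R) :
  concave_on D g -> D a -> D (b + h) -> a <= b -> 0 <= h ->
  g (b + h) - g b <= g (a + h) - g a.
Proof.
move=> g_concave Da Dbh ab h_ge0.
have [->|h0] := eqVneq h 0; first by rewrite !addr0 !subrr.
have h_gt0 : 0 < h by rewrite lt_neqAle eq_sym h0.
have L0 : 0 < b + h - a by lra.
have t01 : 0 <= h / (b + h - a) <= 1.
  by rewrite divr_ge0 ?(ltW L0)//= ler_pdivrMr// mul1r; lra.
pose t01' := Itv01 (andP t01).1 (andP t01).2.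
have := g_concave t01' (b + h) a; rewrite !inE => /(_ Dbh Da).
have := g_concave t01' a (b + h); rewrite !inE => /(_ Da Dbh).
set t := h / (b + h - a).
have tL : t * (b + h - a) = h by rewrite divfK ?gt_eqF.
have convE (x y : R) :
  conv t01' (x : convex_lmodType R^o) y = t * x + (1 - t) * y by [].
rewrite !convE !convRE /= -/t /onem.
have -> : t * (b + h) + (1 - t) * a = a + h.
  transitivity (a + t * (b + h - a)); last by rewrite tL.
  ring.
have -> : t * a + (1 - t) * (b + h) = b.
  transitivity (b + h - t * (b + h - a)); last by rewrite tL addrK.
  ring.
lra.
Qed.

(** Around an interior point of [D] the filter [within D x^'] is [x^'] itself,
    so the derivative along [D] is the usual one. *)
Lemma derivable_within_open (R : realType) (D : set R) (f : R -> R) (x : R) :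
  nbhs x D -> derivable_within D f x ->
  is_derive x 1 f (derive_within D f x).
Proof.
move=> Dx; rewrite /derivable_within /derive_within.
have -> : within D x^' = x^'.
  apply/seteqP; split => P; rewrite /within/=; last first.
    by apply: filterS => y.
  move=> DP; near=> y; apply: (near DP y) => //; near: y.
  exact: nbhs_dnbhs.
set l := lim _ => quot_l.
apply/is_derive1_caratheodory.
exists (fun z => if z == x then l else (f z - f x) / (z - x)).
split; last by rewrite eqxx.
- move=> z; case: eqP => [->|/eqP zx]; first by rewrite !subrr mulr0.
  by rewrite divfK// subr_eq0.
- apply/continuous_withinNx; rewrite eqxx.
  apply: cvg_trans quot_l; apply: near_eq_cvg; near=> z.
  by rewrite ifN//; near: z; exact: nbhs_dnbhs_neq.
Unshelve. all: by end_near. Qed.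

(** * Integrals under isometries of the line *)

(** The pushforward of [mu] by [phi] is [mu], and splitting [f] into its positive
    and negative parts reduces the claim to nonnegative functions. *)
Lemma integral_measure_preserving d (S : measurableType d) (R : realType)
    (mu : {measure set S -> \bar R}) (phi : S -> S) (D : set S)
    (f : S -> \bar R) :
  measurable_fun setT phi ->
  (forall A, measurable A -> mu (phi @^-1` A) = mu A) ->
  measurable D -> measurable_fun D f ->
  (\int[mu]_(x in phi @^-1` D) f (phi x) = \int[mu]_(x in D) f x)%E.
Proof.
move=> mphi phi_mu mD mf.
have ge0_case (u : S -> \bar R) : measurable_fun D u ->
    (forall x, 0 <= u x)%E ->
    (\int[mu]_(x in phi @^-1` D) u (phi x) = \int[mu]_(x in D) u x)%E.
  move=> mu_ u0.
  rewrite -(ge0_integral_pushforward mphi mu mD mu_ (fun y _ => u0 y)).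
  apply: (@eq_measure_integral _ _ _ D mu (pushforward mu phi)) => A mA _.
  exact: phi_mu.
rewrite integralE [RHS]integralE; congr (_ - _)%E.
- rewrite -(ge0_case f^\+%E); [|exact: measurable_funepos|by []].
  by apply: eq_integral => x _; rewrite !funeposE.
- rewrite -(ge0_case f^\-%E); [|exact: measurable_funeneg|by []].
  by apply: eq_integral => x _; rewrite !funenegE.
Qed.

Lemma integrable_measure_preserving d (S : measurableType d) (R : realType)
    (mu : {measure set S -> \bar R}) (phi : S -> S) (D : set S)
    (f : S -> \bar R) :
  measurable_fun setT phi ->
  (forall A, measurable A -> mu (phi @^-1` A) = mu A) ->
  measurable D -> mu.-integrable D f ->
  mu.-integrable (phi @^-1` D) (f \o phi).
Proof.
move=> mphi phi_mu mD /integrableP[mf foo].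
have mphiD : measurable (phi @^-1` D).
  by rewrite -[X in measurable X]setTI; exact: mphi.
apply/integrableP; split.
  apply: (measurable_comp mD) => //.
    by move=> _ [x Dx <-].
  exact: measurable_funTS.
rewrite /= (integral_measure_preserving (f := fun y => `|f y|%E) mphi)//.
exact: measurableT_comp.
Qed.

(** Translations ([e = 1]) and reflections ([e = -1]) preserve the lengths of
    intervals, hence Lebesgue measure by its uniqueness. *)
Lemma lebesgue_measure_affine (R : realType) (c e : R) (A : set R) :
  (e == 1) || (e == -1) -> measurable A ->
  lebesgue_measure ((fun x => c + e * x) @^-1` A) = lebesgue_measure A.
Proof.
move=> e1 mA; apply/esym; pose phi x : measurableTypeR R := c + e * x.
have mphi : measurable_fun [set: measurableTypeR R] phi.
  by apply: measurable_funD => //; exact: measurable_funM.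
pose phi' : {mfun measurableTypeR R >-> measurableTypeR R} :=
  HB.pack phi (isMeasurableFun.Build _ _ _ _ _ mphi).
rewrite -/(pushforward lebesgue_measure phi' A).
apply: lebesgue_measure_unique => // _ [[a b] _ <-].
rewrite /= /phi.
case/orP: e1 => /eqP ->; rewrite /pushforward.
- have -> : (fun x => c + 1 * x) @^-1` `]a, b] = `]a - c, b - c]%classic.
    by apply/seteqP; split => x; rewrite /= !in_itv/= => ?; apply/andP; split; lra.
  rewrite !lebesgue_measure_itv /= !lte_fin ltrD2r -!EFinB.
  by case: ifP => // _; congr EFin; lra.
- have -> : (fun x => c + -1 * x) @^-1` `]a, b] = `[c - b, c - a[%classic.
    by apply/seteqP; split => x; rewrite /= !in_itv/= => ?; apply/andP; split; lra.
  rewrite !lebesgue_measure_itv /= !lte_fin ltrD2l ltrN2 -!EFinB.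
  by case: ifP => // _; congr EFin; lra.
Qed.

Lemma Rintegral_affine (R : realType) (c e : R) (D : set R) (f : R -> R) :
  (e == 1) || (e == -1) -> measurable D ->
  lebesgue_measure.-integrable D (EFin \o f) ->
  lebesgue_measure.-integrable ((fun x => c + e * x) @^-1` D)
    (EFin \o (fun x => f (c + e * x))) /\
  Rintegral lebesgue_measure D f =
  Rintegral lebesgue_measure ((fun x => c + e * x) @^-1` D)
    (fun x => f (c + e * x)).
Proof.
move=> e1 mD intf; pose phi x : measurableTypeR R := c + e * x.
have mphi : measurable_fun [set: measurableTypeR R] phi.
  by apply: measurable_funD => //; exact: measurable_funM.
have phi_mu A :
    measurable A -> lebesgue_measure (phi @^-1` A) = lebesgue_measure A.
  exact: lebesgue_measure_affine.
split; first exact: (integrable_measure_preserving mphi phi_mu mD intf).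
rewrite /Rintegral; congr fine; apply/esym.
have /integrableP[mf _] := intf.
exact: (integral_measure_preserving mphi phi_mu mD mf).
Qed.

(** The left half of the interval is translated onto (0, h/2) and the right half
    is reflected onto it. *)
Lemma Rintegral_fold (R : realType) (a h : R) (f : R -> R) :
  0 < h -> lebesgue_measure.-integrable `]a, a + h] (EFin \o f) ->
  lebesgue_measure.-integrable `]0, h / 2[
    (EFin \o (fun s => f (a + s) + f (a + h - s))) /\
  Rintegral lebesgue_measure `]a, a + h] f =
  Rintegral lebesgue_measure `]0, h / 2[ (fun s => f (a + s) + f (a + h - s)).
Proof.
move=> h_gt0 intf.
have sub1 : `]a, a + h / 2[%classic `<=` `]a, a + h]%classic.
  by move=> x /=; rewrite !in_itv/= => ?; apply/andP; split; lra.
have sub2 : `]a + h / 2, a + h[%classic `<=` `]a, a + h]%classic.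
  by move=> x /=; rewrite !in_itv/= => ?; apply/andP; split; lra.
have int1 : lebesgue_measure.-integrable `]a, a + h / 2[ (EFin \o f).
  by apply: integrableS intf => //; exact: measurable_itv.
have int2 : lebesgue_measure.-integrable `]a + h / 2, a + h[ (EFin \o f).
  by apply: integrableS intf => //; exact: measurable_itv.
have [|i1 e1] := @Rintegral_affine R a 1 _ _ _ (measurable_itv _) int1;
  first by rewrite eqxx.
have [|i2 e2] := @Rintegral_affine R (a + h) (-1) _ _ _ (measurable_itv _) int2;
  first by rewrite eqxx orbT.
have pre1 : (fun x => a + 1 * x) @^-1` `]a, a + h / 2[ = `]0, h / 2[%classic.
  by apply/seteqP; split => x; rewrite /= !in_itv/= => ?; apply/andP; split; lra.
have pre2 : (fun x => a + h + -1 * x) @^-1` `]a + h / 2, a + h[ =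
    `]0, h / 2[%classic.
  by apply/seteqP; split => x; rewrite /= !in_itv/= => ?; apply/andP; split; lra.
rewrite pre1 in i1 e1; rewrite pre2 in i2 e2.
have E1 : (fun x => f (a + 1 * x)) = (fun x => f (a + x)).
  by apply/funext => x; rewrite mul1r.
have E2 : (fun x => f (a + h + -1 * x)) = (fun x => f (a + h - x)).
  by apply/funext => x; rewrite mulN1r.
rewrite E1 in i1 e1; rewrite E2 in i2 e2.
split.
  by apply: (integrableD _ i1 i2); exact: measurable_itv.
rewrite RintegralD// -e1 -e2.
have -> : Rintegral lebesgue_measure `]a + h / 2, a + h[ f =
    Rintegral lebesgue_measure `]a + h / 2, a + h] f.
  exact: Rintegral_itv_bndo_bndc.
rewrite -(@Rintegral_itvB R f _ _ (a + h / 2) intf); last 2 first.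
- by rewrite bnd_simp; lra.
- by rewrite bnd_simp; lra.
rewrite (@Rintegral_itv_bndo_bndc R _ _ _ int1).
by rewrite addrCA subrr addr0.
Qed.

Lemma Rintegral_equipartition (R : realType) (h : R) (n : nat) (f : R -> R) :
  0 < h -> lebesgue_measure.-integrable `]0, n%:R * h] (EFin \o f) ->
  Rintegral lebesgue_measure `]0, n%:R * h] f =
  \sum_(j < n) Rintegral lebesgue_measure `]j%:R * h, j%:R * h + h] f.
Proof.
move=> h_gt0; elim: n => [|n IHn] intf.
  by rewrite big_ord0 mul0r set_itvoc0 Rintegral_set0.
have nh_ge0 : 0 <= n%:R * h by rewrite mulr_ge0// ltW.
have nhS : n.+1%:R * h = n%:R * h + h by rewrite -natr1 mulrDl mul1r.
have intn : lebesgue_measure.-integrable `]0, n%:R * h] (EFin \o f).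
  apply: integrableS intf; [exact: measurable_itv|exact: measurable_itv|].
  by apply: subset_itvl; rewrite bnd_simp nhS lerDl ltW.
rewrite big_ord_recr /= -(IHn intn) -nhS.
rewrite -(@Rintegral_itvB R f _ _ (n%:R * h) intf).
- by rewrite addrCA subrr addr0.
- by rewrite bnd_simp.
- by rewrite bnd_simp nhS lerDl ltW.
Qed.

(** * Power singularities at the origin *)

(** A primitive is x^{1-q} / (1-q); as it vanishes at 0, it bounds the integrals
    over [1/(n+1), b], which increase to the integral over (0, b]. *)
Lemma integral_powRN (R : realType) (q b : R) : 0 < q < 1 -> 0 < b ->
  lebesgue_measure.-integrable `]0, b] (EFin \o (fun x => x `^ (- q))) /\
  Rintegral lebesgue_measure `]0, b] (fun x => x `^ (- q)) <=
    b `^ (1 - q) / (1 - q).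
Proof.
move=> /andP[q_gt0 q_lt1] b_gt0.
have q1 : 1 - q != 0 by lra.
pose F (x : R) := (1 - q)^-1 * x `^ (1 - q).
have dF (x : R) : 0 < x -> is_derive x 1 F (x `^ (- q)).
  move=> x_gt0; have := @is_derive1_powR R (1 - q) x x_gt0 => dx.
  apply: is_derive_eq; rewrite /GRing.scale/= mulrA mulVf// mul1r.
  by congr (_ `^ _); ring.
have mpow (D : set (measurableTypeR R)) :
    measurable_fun D (EFin \o (fun x => x `^ (- q))).
  apply/measurable_EFinP; apply: measurable_funTS; exact: measurable_powR.
have bound : (\int[lebesgue_measure]_(x in `]0%R, b]) (x `^ (- q))%:E <=
    (b `^ (1 - q) / (1 - q))%:E)%E.
  pose G n : set R := `[0 + n.+1%:R^-1, b]%classic.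
  have -> : `]0, b]%classic = \bigcup_n G n by exact: itv_open_bnd_bigcup.
  have ndG : nondecreasing_seq G.
    move=> m n mn; rewrite subsetEset => x; rewrite /G /= !in_itv /= => /andP[mx ->].
    rewrite andbT (le_trans _ mx)// lerD2l lef_pV2 ?posrE ?ltr0n//.
    by rewrite ler_nat ltnS.
  have mG n : measurable (G n : set (measurableTypeR R)) by exact: measurable_itv.
  have f_ge0 n x : G n x -> (0 <= (x `^ (- q))%:E)%E.
    by rewrite lee_fin powR_ge0.
  have := @ge0_nondecreasing_set_cvg_integral _ (measurableTypeR R) R G
    (fun x => (x `^ (- q))%:E) lebesgue_measure ndG mG (fun i => mpow (G i)) f_ge0.
  move=> /cvge_to_le; apply.
  apply: nearW => n; rewrite /G add0r.
  have n_gt0 : (0 : R) < n.+1%:R^-1 by rewrite invr_gt0.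
  (* For small n the interval [1/(n+1), b] is empty or a point. *)
  have [bn|nb] := leP b n.+1%:R^-1.
    have /= -> := @integral_Sset1 R (fun x => (x `^ (- q))%:E) `[n.+1%:R^-1, b] b.
      by rewrite lee_fin divr_ge0 ?powR_ge0//; lra.
    by move=> x; rewrite /= in_itv/= => /andP[nx xb];
      apply/le_anti; rewrite xb (le_trans bn nx).
  have dFi : {in `[n.+1%:R^-1, b]%R, forall x : R, is_derive x 1 F (x `^ (- q))}.
    by move=> x; rewrite in_itv/= => /andP[nx _]; apply: dF;
      exact: lt_le_trans n_gt0 nx.
  rewrite (@continuous_FTC2 _ _ F)//.
  - rewrite -EFinB lee_fin /F mulrC lerBlDr lerDl.
    by rewrite mulr_ge0 ?powR_ge0// invr_ge0; lra.
  - apply: derivable_within_continuous => x xi.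
    have x_gt0 : 0 < x.
      by move: xi; rewrite in_itv/= => /andP[nx _]; exact: lt_le_trans n_gt0 nx.
    by have [] := is_derive1_powR (- q) x_gt0.
  - have cF : {within `[n.+1%:R^-1, b], continuous F}.
      by apply: derivable_within_continuous => x /dFi[].
    have [_ F1 F2] := (continuous_within_itvP F nb).1 cF.
    split => // x xi; have [] // := dFi x _.
    by apply: subset_itv_oo_cc.
  - move=> x xi; have [_ dFx] := dFi x (subset_itv_oo_cc xi).
    by rewrite derive1E dFx.
have intp : lebesgue_measure.-integrable `]0, b] (EFin \o (fun x => x `^ (- q))).
  apply/integrableP; split; first exact: mpow.
  under eq_integral do rewrite /= ger0_norm ?powR_ge0//.
  by apply: le_lt_trans bound _; rewrite ltry.
split => //.
by rewrite -lee_fin /Rintegral fineK//; exact: integrable_fin_num.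
Qed.

(** On [s, t] the derivative of g is at most C t^{q+1-delta} x^{-(q+1)}, so g
    plus a multiple of x^{-q} is decreasing there.  Trading x^{-delta} for
    the power x^{-(q+1)} treats all delta <= q + 1 alike, including delta = 1, where
    integrating x^{-delta} itself would produce a logarithm. *)
Lemma increment_le_powRN (R : realType) (a delta q C : R) (g dg : R -> R)
    (s t : R) :
  {in `]0, a[, forall x : R, is_derive x 1 g (dg x)} ->
  {in `]0, a[, forall x : R, x `^ delta * dg x <= C} ->
  0 <= C -> 0 < q -> delta <= q + 1 -> 0 < s -> s <= t -> t < a ->
  g t - g s <= C / q * t `^ (q + 1 - delta) * s `^ (- q).
Proof.
move=> g_dg dg_le C_ge0 q_gt0 delta_le s_gt0 st ta.
pose K := C / q * t `^ (q + 1 - delta).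
have K_ge0 : 0 <= K by rewrite mulr_ge0 ?powR_ge0// divr_ge0// ltW.
pose psi (x : R) := g x + K * x `^ (- q).
have st_sub (x : R) : x \in `[s, t]%R -> x \in `]0, a[%R.
  by rewrite !in_itv/= => /andP[sx xt]; apply/andP; split; lra.
have dpsi : {in `[s, t], forall x : R,
    is_derive x 1 psi (dg x + K * (- q * x `^ (- q - 1)))}.
  move=> x xst; have := g_dg x (st_sub x xst) => dgx.
  have x_gt0 : 0 < x by move: (st_sub x xst); rewrite in_itv/= => /andP[].
  have := @is_derive1_powR R (- q) x x_gt0 => dx.
  by apply: is_derive_eq.
have dpsi_le0 : {in `[s, t], forall x : R,
    dg x + K * (- q * x `^ (- q - 1)) <= 0}.
  move=> x xst; have := dg_le x (st_sub x xst).
  have x_gt0 : 0 < x by move: (st_sub x xst); rewrite in_itv/= => /andP[].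
  have xt : x <= t by move: xst; rewrite in_itv/= => /andP[].
  move=> dgx_le.
  have -> : K * (- q * x `^ (- q - 1)) =
      - (C * (t `^ (q + 1 - delta) * x `^ (- q - 1))).
    by rewrite /K; field; lra.
  rewrite subr_le0.
  have dgx : dg x <= C * x `^ (- delta).
    rewrite powRN ler_pdivlMr ?powR_gt0//.
    by rewrite mulrC.
  apply: (le_trans dgx); apply: ler_wpM2l => //.
  have -> : x `^ (- delta) = x `^ (q + 1 - delta) * x `^ (- q - 1).
    rewrite -powRD; last by rewrite (gt_eqF x_gt0) implybT.
    by congr (_ `^ _); ring.
  apply: ler_wpM2r; first exact: powR_ge0.
  by apply: ge0_ler_powR; rewrite ?nnegrE; lra.
have psi_ts : psi t <= psi s.
  apply: (@ler0_derive1_le_cc R psi s t) => //.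
  - by move=> x /subset_itv_oo_cc /dpsi[].
  - move=> x /subset_itv_oo_cc xst; have [_ e] := dpsi x xst.
    by rewrite derive1E e; exact: dpsi_le0.
  - by apply: derivable_within_continuous => x /dpsi[].
  - by rewrite in_itv/= lexx st.
  - by rewrite in_itv/= lexx st.
have : 0 <= K * t `^ (- q) by rewrite mulr_ge0 ?powR_ge0.
move: psi_ts; rewrite /psi -/K; lra.
Qed.

(** The growth condition near 0 holds on all of (0, T) with another constant:
    away from 0 the derivative is bounded, being continuous on a compact
    interval. *)
Lemma derive_within_bigO_global (R : realType) (T delta C : R) (g : R -> R) :
  0 < T -> 0 <= delta ->
  {within `]0, T], continuous (derive_within `]0, T] g)} ->
  (\forall x \near (0 : R)^'+, x `^ delta * derive_within `]0, T] g x <= C) ->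
  exists2 C' : R, 0 <= C' &
    {in `]0, T[, forall x : R, x `^ delta * derive_within `]0, T] g x <= C'}.
Proof.
move=> T_gt0 delta_ge0 dg_cont near0.
set dg := derive_within _ _ in dg_cont near0 *.
have [e /= e_gt0 eC] : exists2 e : R, 0 < e <= T &
    forall x, 0 < x < e -> x `^ delta * dg x <= C.
  move: near0 => [e /= e_gt0 eC]; exists (Num.min e T).
    by rewrite lt_min e_gt0 T_gt0 ge_min lexx orbT.
  move=> x /andP[x_gt0]; rewrite lt_min => /andP[xe _]; apply: eC => //=.
  by rewrite sub0r normrN gtr0_norm.
have /andP[e0 eT] := e_gt0.
have e2T : e / 2 <= T by lra.
have [|c cI dg_max] := @EVT_max R dg (e / 2) T e2T.
  apply: continuous_subspaceW dg_cont => x /=; rewrite !in_itv/= => /andP[ex ->].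
  by rewrite andbT; lra.
exists (`|C| + T `^ delta * `|dg c|).
  by rewrite addr_ge0 ?mulr_ge0 ?powR_ge0.
move=> x; rewrite in_itv/= => /andP[x_gt0 xT].
have [xe|ex] := ltP x e.
  apply: (le_trans (eC x _)); first by rewrite x_gt0.
  by apply: (le_trans (ler_norm C)); rewrite lerDl mulr_ge0 ?powR_ge0.
apply: (@le_trans _ _ (x `^ delta * `|dg c|)).
  apply: ler_wpM2l; first exact: powR_ge0.
  apply: le_trans (ler_norm _); apply: dg_max; rewrite in_itv/=;
    apply/andP; split; lra.
apply: ler_wpDl => //; apply: ler_wpM2r => //.
by apply: ge0_ler_powR; rewrite ?nnegrE; lra.
Qed.

(** Monotonicity bounds g above by g(T), and below by g(T/2) on (T/2, T]; only
    the lower bound near 0 needs the power. *)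
Lemma integrable_power_singularity (R : realType) (T K q : R) (g : R -> R) :
  0 < T -> 0 < q < 1 ->
  {in `]0, T[, continuous g} ->
  {in `]0, T] &, {homo g : x y / x <= y}} ->
  (forall s : R, 0 < s <= T / 2 -> g (T / 2) - g s <= K * s `^ (- q)) ->
  lebesgue_measure.-integrable `]0, T] (EFin \o g).
Proof.
move=> T_gt0 q01 g_cont g_incr g_sing.
have T2 : T / 2 \in `]0, T] by rewrite in_itv/=; apply/andP; split; lra.
have TT : T \in `]0, T] by rewrite in_itv/= T_gt0 lexx.
pose M : R := `|g T| + `|g (T / 2)|.
have mg : measurable_fun (`]0, T]%classic : set (measurableTypeR R))
    (EFin \o g).
  apply/measurable_EFinP/measurable_fun_itv_bndo_bndcP.
  by apply: open_continuous_measurable_fun => // x; rewrite inE => /g_cont.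
have [int_pow _] := integral_powRN q01 T_gt0.
have int_M : lebesgue_measure.-integrable `]0, T] (EFin \o cst M).
  apply: measurable_bounded_integrable => //.
  - have : (lebesgue_measure (`]0%R, T]%classic : set R) < +oo)%E.
      by rewrite lebesgue_measure_itv /= lte_fin T_gt0 -EFinB ltry.
    exact.
  - exists M; split; first exact: num_real.
    by move=> N MN x _ /=; rewrite [X in X <= _]ger0_norm ?addr_ge0// ltW.
have int_KP : lebesgue_measure.-integrable `]0, T]
    (EFin \o (fun x : R => `|K| * x `^ (- q))).
  by apply: (integrableZl _ `|K| int_pow); exact: measurable_itv.
have int_dom : lebesgue_measure.-integrable `]0, T]
    (EFin \o (fun x : R => M + `|K| * x `^ (- q))).
  by apply: (integrableD _ int_M int_KP); exact: measurable_itv.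
apply: le_integrable int_dom => // x /=.
rewrite in_itv/= => /andP[x_gt0 xT].
have xTT : x \in `]0, T] by rewrite in_itv/= x_gt0 xT.
have P_ge0 : 0 <= `|K| * x `^ (- q) by rewrite mulr_ge0 ?powR_ge0.
rewrite lee_fin [leRHS]ger0_norm ?addr_ge0//.
have gxT := g_incr x T xTT TT xT.
have := ler_norm (g T); have := ler_norm (- g (T / 2)); rewrite normrN => ? ?.
rewrite ler_norml; apply/andP; split; last first.
  by rewrite /M; have := normr_ge0 (g (T / 2)); lra.
have [xT2|T2x] := leP x (T / 2).
  have := g_sing x; rewrite x_gt0 xT2 => /(_ isT).
  have : K * x `^ (- q) <= `|K| * x `^ (- q).
    by rewrite ler_wpM2r ?powR_ge0// ler_norm.
  by rewrite /M; have := normr_ge0 (g T); lra.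
have := g_incr _ _ T2 xTT (ltW T2x).
by rewrite /M; have := normr_ge0 (g T); lra.
Qed.

(** * Half-periods of the cosine *)

(** Increment of [g] between the two points of the half-period
    (jh, jh + h] that are symmetric about its midpoint. *)
Definition half_period_gap (R : realType) (g : R -> R) (h : R) (j : nat)
    (s : R) : R :=
  g (j%:R * h + h - s) - g (j%:R * h + s).

(** The phase of the cosine is j pi + k pi s / T at jh + s and
    (j + 1) pi - k pi s / T at jh + h - s, so the cosine takes opposite values
    at these two points. *)
Lemma cos_coef_half_period (R : realType) (T : R) (g : R -> R) (n j : nat)
    (h := T / n.+1%:R) (A := fun s => half_period_gap g h j s *
       cos (n.+1%:R * pi * s / T)) :
  0 < T -> (j <= n)%N ->
  lebesgue_measure.-integrable `]0, T]
    (EFin \o cos_coef_integrand T g n.+1) ->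
  lebesgue_measure.-integrable `]0, h / 2[ (EFin \o A) /\
  Rintegral lebesgue_measure `]j%:R * h, j%:R * h + h]
    (cos_coef_integrand T g n.+1) =
  - ((-1) ^+ j * Rintegral lebesgue_measure `]0, h / 2[ A).
Proof.
move=> T_gt0 jn intf; set f := cos_coef_integrand T g n.+1 in intf *.
have n_gt0 : (0 : R) < n.+1%:R by rewrite ltr0n.
have n_neq0 : n.+1%:R != 0 :> R by rewrite gt_eqF.
have T_neq0 : T != 0 by rewrite gt_eqF.
have h_gt0 : 0 < h by rewrite divr_gt0.
have nh : n.+1%:R * h = T by rewrite /h mulrC divfK.
have jhT : j%:R * h + h <= T.
  rewrite -nh -[X in _ + X]mul1r -mulrDl natr1; apply: ler_wpM2r;
    first exact: ltW.
  by rewrite ler_nat.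
have jh_ge0 : 0 <= j%:R * h by rewrite mulr_ge0// ltW.
have intj : lebesgue_measure.-integrable `]j%:R * h, j%:R * h + h] (EFin \o f).
  apply: integrableS intf; [exact: measurable_itv|exact: measurable_itv|].
  by move=> x /=; rewrite !in_itv/= => /andP[? ?]; apply/andP; split; lra.
have [intu ->] := Rintegral_fold h_gt0 intj.
have uE : (fun s => f (j%:R * h + s) + f (j%:R * h + h - s)) =
    (fun s => - (-1) ^+ j * A s).
  have phase (N a s : R) : N != 0 ->
      N * pi * (a * h + s) / (N * h) = a * pi + N * pi * s / (N * h).
    by move=> N_neq0; field; rewrite N_neq0 (gt_eqF h_gt0).
  apply/funext => s; rewrite /f /cos_coef_integrand /A /half_period_gap.
  have -> : n.+1%:R * pi * (j%:R * h + s) / T =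
      j%:R * pi + n.+1%:R * pi * s / T.
    by rewrite -nh phase.
  have -> : n.+1%:R * pi * (j%:R * h + h - s) / T =
      j.+1%:R * pi + - (n.+1%:R * pi * s / T).
    have -> : j%:R * h + h - s = j.+1%:R * h + - s by rewrite -natr1; ring.
    by rewrite -nh phase// mulrN mulNr.
  by rewrite !cosDnatpi cosN exprS; ring.
rewrite uE in intu *.
have intA : lebesgue_measure.-integrable `]0, h / 2[ (EFin \o A).
  have -> : A = (fun s => - (-1) ^+ j * (- (-1) ^+ j * A s)).
    by apply/funext => s; rewrite mulrA mulrNN -expr2 sqrr_sign mul1r.
  by apply: (integrableZl _ (- (-1) ^+ j) intu); exact: measurable_itv.
split => //.
by rewrite RintegralZl ?mulNr.
Qed.

(** The half-period contributions alternate in sign and decrease in size, so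
    their sum is controlled by the first one. *)
Lemma cos_coef_bounds (R : realType) (T : R) (g : R -> R) (n : nat)
    (h := T / n.+1%:R) :
  0 < T -> {in `]0, T] &, {homo g : x y / x <= y}} -> concave_on `]0, T] g ->
  lebesgue_measure.-integrable `]0, T]
    (EFin \o cos_coef_integrand T g n.+1) ->
  - Rintegral lebesgue_measure `]0, h / 2[ (fun s =>
      half_period_gap g h 0 s * cos (n.+1%:R * pi * s / T)) <=
  Rintegral lebesgue_measure `]0, T] (cos_coef_integrand T g n.+1) <= 0.
Proof.
move=> T_gt0 g_incr g_conc intf.
have n_gt0 : (0 : R) < n.+1%:R by rewrite ltr0n.
have h_gt0 : 0 < h by rewrite divr_gt0.
have nh : n.+1%:R * h = T by rewrite /h mulrC divfK ?gt_eqF.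
pose A j s := half_period_gap g h j s * cos (n.+1%:R * pi * s / T).
pose I j := Rintegral lebesgue_measure `]0, h / 2[ (A j).
have jh_le (j : nat) : (j <= n)%N -> j%:R * h + h <= T.
  move=> jn; rewrite -nh -[X in _ + X]mul1r -mulrDl natr1.
  by apply: ler_wpM2r; [exact: ltW|rewrite ler_nat].
have jh_ge0 (j : nat) : 0 <= j%:R * h by rewrite mulr_ge0// ltW.
have cos_ge0 (s : R) : 0 < s < h / 2 -> 0 <= cos (n.+1%:R * pi * s / T).
  move=> /andP[s_gt0 sh]; have pi0 := pi_gt0 R.
  have -> : n.+1%:R * pi * s / T = s / h * pi.
    rewrite -nh; move: n.+1%:R n_gt0 => N N_gt0.
    by field; rewrite !gt_eqF.
  apply: cos_ge0_pihalf.
  have sh_ge0 : 0 <= s / h by rewrite divr_ge0 ?ltW.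
  have sh_le : s / h <= 2^-1 by rewrite ler_pdivrMr//; lra.
  by apply/andP; split; nra.
have gap_ge0 (j : nat) (s : R) : (j <= n)%N -> 0 < s < h / 2 ->
    0 <= half_period_gap g h j s.
  move=> jn /andP[s_gt0 sh]; have := jh_le j jn; have := jh_ge0 j => ? ?.
  rewrite subr_ge0; apply: g_incr; rewrite ?in_itv/=;
    try (apply/andP; split); lra.
have gap_dec (j : nat) (s : R) : (j < n)%N -> 0 < s < h / 2 ->
    half_period_gap g h j.+1 s <= half_period_gap g h j s.
  move=> jn /andP[s_gt0 sh]; have := jh_le j.+1 jn; have := jh_ge0 j => ?.
  rewrite /half_period_gap -natr1 mulrDl mul1r => ?.
  have := @concave_increment_le R `]0, T] g (j%:R * h + s) (j%:R * h + h - s) h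
    g_conc.
  have -> : j%:R * h + h + h - s = j%:R * h + h - s + h by ring.
  have -> : j%:R * h + h + s = j%:R * h + s + h by ring.
  rewrite /= !in_itv/= => /(_ _ _ _ (ltW h_gt0)) H.
  have : g (j%:R * h + h - s + h) - g (j%:R * h + h - s) <=
     g (j%:R * h + s + h) - g (j%:R * h + s).
    by apply: H; try (apply/andP; split); lra.
  lra.
have intA j (jn : (j <= n)%N) :
    lebesgue_measure.-integrable `]0, h / 2[ (EFin \o A j).
  by have [] := cos_coef_half_period T_gt0 jn intf.
have -> : Rintegral lebesgue_measure `]0, T] (cos_coef_integrand T g n.+1) =
    - \sum_(j < n.+1) (-1) ^+ j * I j.
  rewrite -[in `]0, T]]nh Rintegral_equipartition ?nh// -sumrN.
  apply: eq_bigr => j _.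
  have jn : (j <= n)%N by rewrite -ltnS.
  by have [_ ->] := cos_coef_half_period T_gt0 jn intf.
have /andP[sum_ge0 sum_le] : 0 <= \sum_(j < n.+1) (-1) ^+ j * I j <= I 0%N.
  apply: alternating_sum_bounds => j jn.
    apply: Rintegral_ge0 => s /=; rewrite in_itv/= => sI.
    by rewrite mulr_ge0 ?gap_ge0 ?cos_ge0.
  apply: le_Rintegral; [exact: measurable_itv|exact: intA|exact/intA/ltnW|].
  move=> s /=; rewrite in_itv/= => sI.
  by rewrite ler_wpM2r ?gap_dec ?cos_ge0.
by rewrite lerN2 sum_le oppr_le0.
Qed.

(** * Sign and decay of the cosine coefficients *)

Unset Implicit Arguments.

Theorem proposition2p1 (R : realType) (T delta : R) (g : R -> R)
    (T_gt0 : 0 < T) (delta_ge0 : 0 <= delta) (delta_lt2 : delta < 2)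
    (g_C1 : continuously_differentiable_on `]0, T] g)
    (g_increasing : {in `]0, T] &, {homo g : x y / x <= y}})
    (g_concave : concave_on `]0, T] g)
    (g_bigO : exists2 C : R, 0 < C &
       \forall x \near (0 : R)^'+, x `^ delta * derive_within `]0, T] g x <= C) :
  [/\ lebesgue_measure.-integrable `]0, T] (EFin \o g) /\
      (forall k : nat, lebesgue_measure.-integrable `]0, T]
         (EFin \o cos_coef_integrand T g k)),
      (forall k : nat, (1 <= k)%N -> cos_coef T g k <= 0) &
      (exists2 C : R, 0 < C & forall k : nat, (1 <= k)%N ->
         `|cos_coef T g k| <= C * (1 / k%:R `^ (2 - delta)))].
Proof.
have [g_der dg_cont] := g_C1.
pose dg := derive_within `]0, T] g.
have dgP : {in `]0, T[, forall x : R, is_derive x 1 g (dg x)}.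
  move=> x xT; apply: derivable_within_open.
    have : nbhs x `]0, T[%classic.
      by apply: open_nbhs_nbhs; split; [exact: interval_open|].
    by apply: filterS; apply: subset_itvl; rewrite bnd_simp.
  apply: g_der; rewrite inE; exact: subset_itv_oo_oc.
have [C C_ge0 dg_le] : exists2 C : R, 0 <= C &
    {in `]0, T[, forall x : R, x `^ delta * dg x <= C}.
  have [C0 _ C0P] := g_bigO.
  exact: derive_within_bigO_global C0P.
(* Any q with max(delta - 1, 0) < q < 1 would do. *)
pose q := (1 + delta) / 3.
have q_gt0 : 0 < q by rewrite /q; lra.
have q_lt1 : q < 1 by rewrite /q; lra.
have delta_q : delta <= q + 1 by rewrite /q; lra.
have g_incr_le (s t : R) :=
  @increment_le_powRN R T delta q C g dg s t dgP dg_le C_ge0 q_gt0 delta_q.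
have intg : lebesgue_measure.-integrable `]0, T] (EFin \o g).
  apply: (@integrable_power_singularity R T
    (C / q * (T / 2) `^ (q + 1 - delta)) q) => //.
  - by rewrite q_gt0.
  - move=> x xT; apply/differentiable_continuous/derivable1_diffP.
    by have [] := dgP x xT.
  - by move=> s /andP[s_gt0 sT]; apply: g_incr_le => //; lra.
have intf k : lebesgue_measure.-integrable `]0, T]
    (EFin \o cos_coef_integrand T g k).
  have mcos : measurable_fun (setT : set (measurableTypeR R))
      (fun t : R => cos (k%:R * pi * t / T)).
    apply: measurableT_comp.
      by apply: continuous_measurable_fun; exact: continuous_cos.
    by apply: measurable_funM => //; exact: measurable_funM.
  have /integrableP[mg _] := intg.
  apply: le_integrable intg => //.
  - apply/measurable_EFinP; apply: measurable_funM.
      exact/measurable_EFinP.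
    exact: measurable_funTS.
  - move=> x _ /=; rewrite lee_fin normrM.
    by rewrite ler_piMr ?cos_max.
have bounds n := @cos_coef_bounds R T g n T_gt0 g_increasing g_concave (intf n.+1).
split; first by [].
- move=> [//|n] _; have /andP[_ le0] := bounds n.
  by rewrite /cos_coef mulr_ge0_le0 // divr_ge0 // ltW.
(* The summand 1 makes the constant positive when C = 0. *)
exists (2 / T * (C / q / (1 - q) * T `^ (2 - delta)) + 1).
  rewrite ltr_wpDl// mulr_ge0 ?divr_ge0 ?(ltW T_gt0)// mulr_ge0 ?powR_ge0//.
  by rewrite divr_ge0 ?subr_ge0 ?(ltW q_lt1)// divr_ge0// ltW.
move=> [//|n] _; have := bounds n; set h := T / n.+1%:R => /andP[ge le0].
have n_gt0 : (0 : R) < n.+1%:R by rewrite ltr0n.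
have h_gt0 : 0 < h by rewrite divr_gt0.
have hT : h <= T by rewrite /h ler_pdivrMr// ler_peMr ?(ltW T_gt0)// ler1n.
set A0 := Rintegral _ _ _ in ge.
have A0_le : A0 <= C / q / (1 - q) * h `^ (2 - delta).
  have h2_gt0 : 0 < h / 2 by lra.
  have q01 : 0 < q < 1 by rewrite q_gt0.
  have [int_pow pow_le] := integral_powRN q01 h2_gt0.
  pose K := C / q * h `^ (q + 1 - delta).
  have K_ge0 : 0 <= K by rewrite mulr_ge0 ?powR_ge0// divr_ge0// ltW.
  have int_pow' : lebesgue_measure.-integrable `]0, h / 2[
      (EFin \o (fun x : R => x `^ (- q))).
    apply: integrableS int_pow; [exact: measurable_itv|exact: measurable_itv|].
    by apply: subset_itvl; rewrite bnd_simp.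
  have A0_le1 : A0 <=
      Rintegral lebesgue_measure `]0, h / 2[ (fun x : R => K * x `^ (- q)).
    apply: le_Rintegral; first exact: measurable_itv.
    - by have [] := cos_coef_half_period T_gt0 (leq0n n) (intf n.+1).
    - by apply: (integrableZl _ K int_pow'); exact: measurable_itv.
    move=> s /=; rewrite in_itv/= => /andP[s_gt0 sh].
    have gap_le : half_period_gap g h 0 s <= K * s `^ (- q).
      rewrite /half_period_gap !mul0r !add0r.
      have sh' : s <= h - s by lra.
      have hsT : h - s < T by lra.
      apply: (le_trans (g_incr_le s (h - s) s_gt0 sh' hsT)).
      rewrite ler_wpM2r ?powR_ge0// ler_wpM2l//; first by rewrite divr_ge0// ltW.
      by apply: ge0_ler_powR; rewrite ?nnegrE; lra.
    have KP_ge0 : 0 <= K * s `^ (- q) by rewrite mulr_ge0 ?powR_ge0.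
    have gap_ge0 : 0 <= half_period_gap g h 0 s.
      rewrite /half_period_gap !mul0r !add0r subr_ge0.
      by apply: g_increasing; rewrite ?in_itv/=; try (apply/andP; split); lra.
    apply: le_trans gap_le.
    by rewrite ler_piMr ?cos_le1.
  apply: (le_trans A0_le1); rewrite RintegralZl//.
  have -> : C / q / (1 - q) * h `^ (2 - delta) = K * (h `^ (1 - q) / (1 - q)).
    have -> : 2 - delta = (q + 1 - delta) + (1 - q) by ring.
    rewrite powRD; last by rewrite (gt_eqF h_gt0) implybT.
    by rewrite /K; field; rewrite ?gt_eqF ?subr_gt0.
  rewrite ler_wpM2l// Rintegral_itv_bndo_bndc//.
  apply: (le_trans pow_le); rewrite ler_wpM2r ?invr_ge0 ?subr_ge0 ?(ltW q_lt1)//.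
  by apply: ge0_ler_powR; rewrite ?nnegrE; lra.
rewrite /cos_coef normrM (ger0_norm (_ : 0 <= 2 / T));
  last by rewrite divr_ge0// ltW.
rewrite ler0_norm//.
have hE : h `^ (2 - delta) = T `^ (2 - delta) * (1 / n.+1%:R `^ (2 - delta)).
  by rewrite /h powRM ?invr_ge0 ?(ltW T_gt0)// -powR_inv1// -powRrM
     mulN1r powRN div1r.
have n_ge0 : 0 <= 1 / n.+1%:R `^ (2 - delta) :> R.
  by rewrite div1r invr_ge0 powR_ge0.
have lead_le : 2 / T * - Rintegral lebesgue_measure `]0, T]
    (cos_coef_integrand T g n.+1) <=
    2 / T * (C / q / (1 - q) * h `^ (2 - delta)).
  by apply: ler_wpM2l; [rewrite divr_ge0// ltW|lra].
rewrite hE in lead_le.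
apply: (le_trans lead_le).
by rewrite [leRHS]mulrDl [X in _ <= _ + X]mul1r !mulrA lerDl.
Qed.
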